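(* Let $\mathcal M$ be an o-minimalistic structure and let $f\colon Y\to M$ be a definable map with $Y\subseteq M$. Then the set of discontinuities of $f$ is discrete, closed, and bounded, and consists entirely of jump discontinuities. Moreover, there is a definable, discrete, closed, bounded subset $D\subseteq Y$ such that in between any two consecutive points of $D\cup\{\pm\infty\}$, the map $f$ is monotone, that is to say, either strictly increasing, strictly decreasing, or constant.
   Context: Let $L$ be a first-order language containing a binary relation symbol $<$; all $L$-structures are assumed to be dense linear orders without endpoints with respect to $<$, and are equipped with the order topology. Definable means definable with parameters; a map is definable if its graph is. An $L$-structure is o-minimal if every definable subset of its universe is a finite union of points and open intervals. An $L$-structure is o-minimalistic if it satisfies every $L$-sentence that holds in every o-minimal $L$-structure. A subset is discrete if it is discrete in the subspace topology. A map $f\colon Y\to M$ with $Y\subseteq M$ has a jump discontinuity at a point $c$ if the left and right limit of $f$ at $c$ exist, but are different; one-sided limits are allowed to take the values $\pm\infty$. Two points $p<q$ of $D\cup\{\pm\infty\}$ are consecutive if no element of $D$ lies strictly between them.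
   Formalization: Two false clauses mended: a discontinuity may also be removable (equal one-sided limits differing from the value) or one-sided (Y on one side only, limit differs from the value); between consecutive points of D ∪ {±∞}, f is claimed monotone on each convex subset of Y there. *)

(* Defs.v *)
From HB Require Import structures.
From mathcomp Require Import all_boot all_order all_algebra.
From mathcomp Require Import all_classical constructive_ereal topology.

Set Implicit Arguments.
Unset Strict Implicit.
Unset Printing Implicit Defensive.

Import Order.TTheory.

Local Open Scope classical_set_scope.
Local Open Scope order_scope.

(* Every language considered contains the symbol <; it is built into the syntax
   (constructor [FLt]) and is not listed in [rsym]. Constants are function
   symbols of arity 0. *)
Record language := Language {
  fsym : Type;
  farity : fsym -> nat;
  rsym : Type;
  rarity : rsym -> nat
}.

(* The universe is a linear order equipped with its order topology (this is what
   [orderTopologicalType] means), and < is interpreted by the order. *)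
Record structure (L : language) := Structure {
  disp : Order.disp_t;
  univ :> orderTopologicalType disp;
  fun_interp : forall s : fsym L, ('I_(farity s) -> univ) -> univ;
  rel_interp : forall r : rsym L, ('I_(rarity r) -> univ) -> Prop;
  univ_inhabited : inhabited univ;
  univ_dense : forall x y : univ, x < y -> exists z, x < z < y;
  univ_no_min : forall x : univ, exists y, y < x;
  univ_no_max : forall x : univ, exists y, x < y
}.

Section Syntax.
Variable L : language.

Inductive term (n : nat) : Type :=
| TVar of 'I_n
| TApp (s : fsym L) of ('I_(farity s) -> term n).

(* [formula n]: first-order formulas with free variables among n variables.
   [FEx] binds variable 0 and shifts the others by one. *)
Inductive formula : nat -> Type :=
| FEq n of term n & term n : formula n
| FLt n of term n & term n : formula n
| FRel n (r : rsym L) of ('I_(rarity r) -> term n) : formula n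
| FNot n of formula n : formula n
| FAnd n of formula n & formula n : formula n
| FEx n of formula n.+1 : formula n.

Definition sentence := formula 0.

End Syntax.

Section Semantics.
Variables (L : language) (M : structure L).

Fixpoint eval n (e : 'I_n -> M) (t : term L n) : M :=
  match t with
  | TVar i => e i
  | TApp s a => fun_interp (fun i => eval e (a i))
  end.

Definition extend n (x : M) (e : 'I_n -> M) : 'I_n.+1 -> M :=
  fun i => oapp e x (unlift ord0 i).

Fixpoint sat n (phi : formula L n) : ('I_n -> M) -> Prop :=
  match phi with
  | FEq _ t u => fun e => eval e t = eval e u
  | FLt _ t u => fun e => eval e t < eval e u
  | FRel _ r a => fun e => rel_interp (fun i => eval e (a i))
  | FNot _ p => fun e => ~ sat p e
  | FAnd _ p q => fun e => sat p e /\ sat q e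
  | FEx _ p => fun e => exists x, sat p (extend x e)
  end.

Definition holds (phi : sentence L) : Prop := forall e : 'I_0 -> M, sat phi e.

(* Subsets of M^n definable with parameters [a]. *)
Definition definable n (A : set ('I_n -> M)) : Prop :=
  exists m (phi : formula L (n + m)) (a : 'I_m -> M),
    A = [set x : 'I_n -> M | sat phi (fun i => match fintype.split i with
                                   | inl j => x j
                                   | inr k => a k
                                   end)].

Definition definable_set (A : set M) : Prop :=
  definable [set x : 'I_1 -> M | A (x ord0)].

(* A map Y -> M is represented by a total function f together with Y; the values
   of f outside Y are irrelevant here and in all notions below. *)
Definition definable_map (Y : set M) (f : M -> M) : Prop :=
  definable [set x : 'I_2 -> M | Y (x ord0) /\ x ord_max = f (x ord0)].

(* [itv_open_ends]: ]a, b[, ]a, +oo[, ]-oo, b[ or ]-oo, +oo[. *)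
Definition o_minimal : Prop :=
  forall A : set M, definable_set A ->
    exists F : set (set M),
      [/\ finite_set F,
          forall B, F B -> (exists x, B = [set x]) \/
                    (exists i : interval M, itv_open_ends i /\ B = [set` i]) &
          A = \bigcup_(B in F) B].

End Semantics.

Definition o_minimalistic (L : language) (M : structure L) : Prop :=
  forall phi : sentence L,
    (forall N : structure L, o_minimal N -> holds N phi) -> holds M phi.

Section OrderNotions.
Variables (d : Order.disp_t) (M : orderTopologicalType d).
Implicit Types (Y D C : set M) (f : M -> M) (c : M).

Definition discrete_set D : Prop := D `<=` isolated D.

Definition order_bounded D : Prop := has_lbound D /\ has_ubound D.

Definition discontinuities Y f : set M :=
  [set c | Y c /\ ~ (f @ within Y (nbhs c) --> f c)].

(* [\bar M] is M with the two extra points -oo and +oo; the library puts an order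
   and a topology on it only when M is a numeric type. *)
Definition ext_nbhs (l : \bar M) : set_system M :=
  match l with
  | EFin a => nbhs a
  | EPInf => filter_from setT (fun a : M => [set` `]a, +oo[])
  | ENInf => filter_from setT (fun a : M => [set` `]-oo, a[])
  end.

Definition left_part Y c : set M := Y `&` [set` `]-oo, c[].
Definition right_part Y c : set M := Y `&` [set` `]c, +oo[].

(* A one-sided limit only makes sense at a point that the domain accumulates at
   from that side; without that condition every l would be a limit. *)
Definition left_limit Y f c (l : \bar M) : Prop :=
  limit_point (left_part Y c) c /\
  f @ within (left_part Y c) (nbhs c) `=>` ext_nbhs l.

Definition right_limit Y f c (l : \bar M) : Prop :=
  limit_point (right_part Y c) c /\
  f @ within (right_part Y c) (nbhs c) `=>` ext_nbhs l.

Definition jump_discontinuity Y f c : Prop :=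
  exists l r, [/\ left_limit Y f c l, right_limit Y f c r & l <> r].

(* Both one-sided limits exist and agree, but f takes another value at c: the
   indicator function of a point is such a map, definable in every structure. *)
Definition removable_discontinuity Y f c : Prop :=
  exists l, [/\ left_limit Y f c l, right_limit Y f c l & l <> EFin (f c)].

(* The domain accumulates at c from one side only, and the limit from that side
   exists but is not the value at c. *)
Definition endpoint_discontinuity Y f c : Prop :=
  (exists l, [/\ left_limit Y f c l, ~ limit_point (right_part Y c) c &
                 l <> EFin (f c)]) \/
  (exists r, [/\ right_limit Y f c r, ~ limit_point (left_part Y c) c &
                 r <> EFin (f c)]).

Definition ext_lt (p q : \bar M) : Prop :=
  match p, q with
  | EFin a, EFin b => a < b
  | EFin _, EPInf | ENInf, EFin _ | ENInf, EPInf => True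
  | _, _ => False
  end.

(* D together with -oo and +oo *)
Definition ext_set D : set (\bar M) :=
  [set p | if p is EFin a then D a else True].

Definition between (p q : \bar M) : set M :=
  [set x | ext_lt p (EFin x) /\ ext_lt (EFin x) q].

Definition consecutive D (p q : \bar M) : Prop :=
  [/\ ext_set D p, ext_set D q, ext_lt p q & D `&` between p q = set0].

(* Between two consecutive points of a subset of Y, the domain Y may still have
   gaps, and f may be monotone of different kinds on the two sides of a gap (say
   Y = ]0, 1[ `|` ]2, 3[, f the identity on ]0, 1[ and a constant on ]2, 3[).
   Monotonicity is therefore claimed on the convex subsets of
   Y `&` between p q, that is, on that whole set when it is convex. *)
Definition order_convex C : Prop :=
  forall x y z, C x -> C y -> x <= z <= y -> C z.

Definition monotone_on C f : Prop :=
  [\/ forall x y, C x -> C y -> x < y -> f x < f y,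
      forall x y, C x -> C y -> x < y -> f y < f x |
      forall x y, C x -> C y -> f x = f y].

End OrderNotions.

(* Main.v *)
Require Import Defs.
From mathcomp Require Import all_boot all_order all_algebra.
From mathcomp Require Import all_classical constructive_ereal topology.

Set Implicit Arguments.
Unset Strict Implicit.
Unset Printing Implicit Defensive.

Import Order.TTheory.

Local Open Scope classical_set_scope.
Local Open Scope order_scope.

(** Two properties of the definable subsets A of M carry the proof. At every
    point, on either side, and at either end of M, A is eventually true or
    eventually false; and A, if nonempty and bounded, has a least bound. A set
    with both properties (in one of the two directions) is called [tame]. For
    each formula, tameness is a sentence. Finite unions of points and open
    intervals are tame, so the sentence holds in all o-minimal structures, hence
    in M: this is [o_minimalistic_tame]. The rest of the proof uses only this
    and the density of M.

    In other words, the germs at a one-sided place decide definable sets, as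
    ultrafilters do, and [germ_push] says that a definable map F sends such a
    place to another one, or is eventually constant: one-sided limits exist. The
    role of finite sets is played by the definable sets without interior: by the
    germ dichotomy they are discrete, closed and bounded. Every place avoids
    such a set, so by [germ_push] a definable map with values in it is constant
    close to any place ([germ_into_no_interior]).

    For monotonicity, compare F near x with F x on either side of x. If F equals
    F x on one side of some x, it is constant on an interval. Otherwise the
    germ dichotomy gives a subinterval where the two comparisons, > or <, do not
    depend on x. If they are opposite, F is strictly monotone there
    ([local_to_global]); that they agree, every point being a strict local
    extremum of the same kind, is impossible ([no_strict_extrema]). So the
    points of Y near which F is not monotone on an interval contained in Y form
    a definable set without interior, which is the D of the theorem. On a convex
    subset of Y avoiding D the local kind of monotonicity is locally constant,
    hence constant ([monotone_on_convex]). Finally, a strictly monotone F on an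
    interval has a range with interior, hence a point of continuity, so the
    discontinuities have no interior either. *)

(** * Oriented linear orders and germs *)

(** The order read from left to right (true) or from right to left (false), so
    that statements about the two sides of a point are proved once. *)
Definition olt d (T : porderType d) (b : bool) (x y : T) : bool :=
  if b then x < y else y < x.

Definition ole d (T : porderType d) (b : bool) (x y : T) : bool :=
  if b then x <= y else y <= x.

Arguments olt : simpl never.
Arguments ole : simpl never.

Section GermDefinitions.
Variables (d : Order.disp_t) (T : porderType d).

(** A pair (b, p) is a one-sided place: the side of the point c reached in the
    direction b when p = Some c, and the end of the line at which the direction
    b starts when p = None. *)
Definition after (b : bool) (p : option T) (x : T) : bool :=
  if p is Some c then olt b c x else true.

Definition germ (b : bool) (p : option T) (P : T -> Prop) : Prop :=
  exists2 y, after b p y & forall x, after b p x -> olt b x y -> P x.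

(** Greatest lower bound when b is false. *)
Definition is_lub (b : bool) (A : T -> Prop) (s : T) : Prop :=
  (forall x, A x -> ole b x s) /\
  (forall t, olt b t s -> exists x, A x /\ olt b t x).

Definition germ_decided b p A : Prop := germ b p A \/ germ b p (fun x => ~ A x).

Definition tame b (A : T -> Prop) : Prop :=
  [/\ forall c, germ_decided b (Some c) A, germ_decided b None A &
      (exists x, A x) -> (exists u, forall x, A x -> ole b x u) ->
      exists s, is_lub b A s].

End GermDefinitions.

Section Oriented.
Variables (d : Order.disp_t) (T : orderType d).
Implicit Types (b : bool) (x y z : T).

Lemma olt_trans b y x z : olt b x y -> olt b y z -> olt b x z.
Proof.
by case: b; rewrite /olt => h1 h2; [exact: lt_trans h2|exact: lt_trans h1].
Qed.

Lemma oltxx b x : olt b x x = false.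
Proof. by case: b; rewrite /olt ltxx. Qed.

Lemma oltN b x y : olt (~~ b) x y = olt b y x.
Proof. by case: b. Qed.

Lemma oleNgt b x y : ole b x y = ~~ olt b y x.
Proof. by case: b; rewrite /ole /olt leNgt. Qed.

Lemma oltW b x y : olt b x y -> ole b x y.
Proof. by case: b; exact: ltW. Qed.

Lemma ole_lt_trans b y x z : ole b x y -> olt b y z -> olt b x z.
Proof.
by case: b; rewrite /ole /olt => h1 h2;
  [exact: le_lt_trans h2|exact: lt_le_trans h1].
Qed.

Lemma olt_le_trans b y x z : olt b x y -> ole b y z -> olt b x z.
Proof.
by case: b; rewrite /ole /olt => h1 h2;
  [exact: lt_le_trans h2|exact: le_lt_trans h1].
Qed.

Lemma ole_eqVlt b x y : ole b x y -> x = y \/ olt b x y.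
Proof.
by case: b; rewrite /ole /olt le_eqVlt => /orP[/eqP|]; [left|right|left|right].
Qed.

Lemma olt_total b x y : [\/ olt b x y, x = y | olt b y x].
Proof.
by case: b; rewrite /olt; case: (ltgtP x y);
  [constructor 1|constructor 3|constructor 2|constructor 3|constructor 1|constructor 2].
Qed.

Lemma after_trans b p x y : after b p x -> olt b x y -> after b p y.
Proof. by case: p => //= c; exact: olt_trans. Qed.

Definition omin b x y : T := if olt b x y then x else y.

Lemma olt_omin b x y z : olt b z (omin b x y) = olt b z x && olt b z y.
Proof.
rewrite /omin; case: ifPn => h.
  by apply/idP/andP => [h'|[]//]; split=> //; exact: olt_trans h.
rewrite -oleNgt in h.
by apply/idP/andP => [h'|[]//]; split=> //; exact: olt_le_trans h.
Qed.

Lemma after_omin b p x y : after b p x -> after b p y -> after b p (omin b x y).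
Proof. by rewrite /omin; case: ifP. Qed.

Lemma germS b p (P Q : T -> Prop) :
  (forall x, P x -> Q x) -> germ b p P -> germ b p Q.
Proof. by move=> PQ [y py h]; exists y => // x px xy; apply/PQ/h. Qed.

Lemma germI b p (P Q : T -> Prop) :
  germ b p P -> germ b p Q -> germ b p (fun x => P x /\ Q x).
Proof.
move=> [y py hy] [z pz hz]; exists (omin b y z); first exact: after_omin.
by move=> x px; rewrite olt_omin => /andP[xy xz]; split; [exact: hy|exact: hz].
Qed.

Lemma germ_itv b x y : olt b x y ->
  germ b (Some x) (fun z => olt b x z /\ olt b z y).
Proof. by move=> xy; exists y. Qed.

End Oriented.

Section DenseOrder.
Variables (L : language) (M : structure L).
Implicit Types (b : bool) (x y z : M) (p : option M).

Lemma olt_dense b x y : olt b x y -> exists2 z, olt b x z & olt b z y.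
Proof.
by case: b => /univ_dense[z /andP[? ?]]; exists z.
Qed.

Lemma olt_unbounded b x : exists y, olt b x y.
Proof. by case: b; [exact: univ_no_max|exact: univ_no_min]. Qed.

Lemma after_dense b p y : after b p y -> exists2 z, after b p z & olt b z y.
Proof.
case: p => [c|_]; first exact: olt_dense.
by have [z] := olt_unbounded (~~ b) y; rewrite oltN; exists z.
Qed.

Lemma after_nonempty b p : exists y, after b p y.
Proof.
case: p => [c|]; first exact: olt_unbounded.
by have [y] := univ_inhabited M; exists y.
Qed.

(** Density, and the absence of endpoints, make every one-sided neighbourhood
    nonempty: germs form proper filters. *)
Lemma germ_ex b p (P : M -> Prop) : germ b p P -> exists2 x, after b p x & P x.
Proof.
move=> [y /[dup] py /after_dense[z pz zy] h]; exists z => //; exact: h.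
Qed.

Lemma germ_disjoint b p (P : M -> Prop) :
  germ b p P -> germ b p (fun x => ~ P x) -> False.
Proof. by move=> h1 h2; have [x _ []] := germ_ex (germI h1 h2). Qed.

Lemma germT b p (P : M -> Prop) : (forall x, P x) -> germ b p P.
Proof. by move=> h; have [y py] := after_nonempty b p; exists y. Qed.

End DenseOrder.

(** * First-order definability *)

Section Renaming.
Variable L : language.

Fixpoint ren_term m n (r : 'I_m -> 'I_n) (t : term L m) : term L n :=
  match t with
  | TVar i => TVar L (r i)
  | TApp s a => TApp (fun i => ren_term r (a i))
  end.

Definition lift_ren m n (r : 'I_m -> 'I_n) (i : 'I_m.+1) : 'I_n.+1 :=
  if unlift ord0 i is Some j then lift ord0 (r j) else ord0.

(** Renaming of free variables; it is what puts two formulas over a common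
    context, and what reorders the variables of a formula. *)
Fixpoint ren m (phi : formula L m) : forall n, ('I_m -> 'I_n) -> formula L n :=
  match phi with
  | FEq _ t u => fun _ r => FEq (ren_term r t) (ren_term r u)
  | FLt _ t u => fun _ r => FLt (ren_term r t) (ren_term r u)
  | FRel _ s a => fun _ r => FRel (fun i => ren_term r (a i))
  | FNot _ p => fun _ r => FNot (ren p r)
  | FAnd _ p q => fun _ r => FAnd (ren p r) (ren q r)
  | FEx _ p => fun _ r => FEx (ren p (lift_ren r))
  end.

Lemma eval_ren (M : structure L) m n (r : 'I_m -> 'I_n) (e : 'I_n -> M) t :
  Defs.eval e (ren_term r t) = Defs.eval (fun i => e (r i)) t.
Proof.
elim: t => //= s a IH; congr fun_interp; apply: funext => i; exact: IH.
Qed.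

Lemma extend_lift_ren (M : structure L) m n (r : 'I_m -> 'I_n) (e : 'I_n -> M) x :
  (fun i => extend x e (lift_ren r i)) = extend x (fun i => e (r i)).
Proof.
apply: funext => i; rewrite /extend /lift_ren.
by case: (unlift ord0 i) => [j|]; rewrite ?liftK ?unlift_none.
Qed.

Lemma sat_ren (M : structure L) m (phi : formula L m) :
  forall n (r : 'I_m -> 'I_n) (e : 'I_n -> M),
  sat (ren phi r) e <-> sat phi (fun i => e (r i)).
Proof.
elim: phi => {m} [m t u|m t u|m s a|m p IH|m p IHp q IHq|m p IH] n r e /=.
- by rewrite !eval_ren.
- by rewrite !eval_ren.
- suff -> : (fun i => Defs.eval e (ren_term r (a i))) =
            (fun i => Defs.eval (fun i0 => e (r i0)) (a i)) by [].
  by apply: funext => i; rewrite eval_ren.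
- by rewrite IH.
- by rewrite IHp IHq.
- by split=> -[x px]; exists x; move: px; rewrite IH extend_lift_ren.
Qed.

Fixpoint closure_all n : formula L n -> sentence L :=
  match n with
  | 0 => id
  | n'.+1 => fun phi => closure_all (FNot (FEx (FNot phi)))
  end.

Lemma holds_closure_all (M : structure L) n (phi : formula L n) :
  holds M (closure_all phi) <-> forall e : 'I_n -> M, sat phi e.
Proof.
elim: n phi => [|n IH] phi //=; rewrite IH; split => [h e|h e /= [x]]; last first.
  by apply; exact: h.
have := h (fun i => e (lift ord0 i)); rewrite /=.
move=> /forallNP/(_ (e ord0))/contrapT.
suff -> : extend (e ord0) (fun i => e (lift ord0 i)) = e by [].
by apply: funext => i; rewrite /extend; case: unliftP => [j|] ->.
Qed.

End Renaming.

Section FirstOrder.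
Variables (L : language) (I : Type) (S : I -> structure L).
Variables (K : Type) (cst : K -> forall i, S i).

Definition lookup i (e : nat -> S i) (v : nat + K) : S i :=
  match v with inl k => e k | inr k => cst k i end.

(** A family of predicates, one on each structure S i, is first-order when it is
    given by a single formula for all i; environments are infinite, and each
    variable of the formula is sent to an index of the environment or to a
    constant. Two cases matter: all structures at once without constants, for
    transfer, and one structure with its points as constants, for definability
    with parameters. As P appears as a function of the environment, the closure
    lemmas below can be applied to ordinary mathematical notation, a bound
    variable being index 0 in the scope of its quantifier. *)
Definition fo (P : forall i, (nat -> S i) -> Prop) : Prop :=
  exists n (phi : formula L n) (v : 'I_n -> nat + K),
    forall i e, P i e <-> sat phi (fun j => lookup e (v j)).

(** Terms are encoded by their graphs, so that definable maps count as terms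
    too. *)
Definition fo_term (t : forall i, (nat -> S i) -> S i) : Prop :=
  fo (fun i e => t i (fun k => e k.+1) = e 0).

Implicit Types (P Q : forall i, (nat -> S i) -> Prop).

Lemma fo_ext P Q : (forall i e, P i e <-> Q i e) -> fo P -> fo Q.
Proof.
by move=> PQ [n [phi [v h]]]; exists n, phi, v => i e; rewrite -PQ.
Qed.

Lemma fo_ren P (r : nat -> nat) : fo P ->
  fo (fun i e => P i (fun k => e (r k))).
Proof.
move=> [n [phi [v h]]].
exists n, phi, (fun j => if v j is inl k then inl (r k) else v j) => i e.
rewrite h; set e1 := (X in sat _ X); set e2 := (X in _ <-> sat _ X).
suff -> : e1 = e2 by [].
by apply: funext => j; rewrite /e1 /e2; case: (v j).
Qed.

Lemma fo_not P : fo P -> fo (fun i e => ~ P i e).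
Proof.
by move=> [n [phi [v h]]]; exists n, (FNot phi), v => i e; rewrite h.
Qed.

Lemma fo_and P Q : fo P -> fo Q -> fo (fun i e => P i e /\ Q i e).
Proof.
move=> [n [phi [v h]]] [m [psi [w g]]].
exists (n + m)%N, (FAnd (ren phi (@lshift n m)) (ren psi (@rshift n m))).
exists (fun j => match fintype.split j with inl k => v k | inr k => w k end).
move=> i e /=.
rewrite !sat_ren h g.
set e1 := (X in sat phi X /\ _); set e2 := (X in _ <-> sat phi X /\ _).
set e3 := (X in (_ /\ sat psi X) <-> _).
set e4 := (X in _ <-> (_ /\ sat psi X)).
have -> : e1 = e2.
  by apply: funext => j; rewrite /e1 /e2 (unsplitK (inl j)).
suff -> : e3 = e4 by [].
by apply: funext => j; rewrite /e3 /e4 (unsplitK (inr j)).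
Qed.

Lemma fo_ex (P : forall i, (nat -> S i) -> S i -> Prop) :
  fo (fun i e => P i (fun k => e k.+1) (e 0)) ->
  fo (fun i e => exists x, P i e x).
Proof.
move=> [n [phi [v h]]].
pose r (j : 'I_n) : 'I_n.+1 := if v j is inl 0 then ord0 else lift ord0 j.
exists n, (FEx (ren phi r)).
exists (fun j => if v j is inl k then inl k.-1 else v j) => i e /=.
suff hx x : P i e x <-> sat (ren phi r)
    (extend x (fun j => lookup e (if v j is inl k then inl k.-1 else v j))).
  by split=> -[x] /hx; exists x.
pose ex k := if k is k'.+1 then e k' else x.
rewrite sat_ren; have := h i ex; rewrite /= => ->.
set e1 := (X in sat _ X); set e2 := (X in _ <-> sat _ X).
suff -> : e1 = e2 by [].
apply: funext => j; rewrite /e1 /e2 /r /extend.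
case E: (v j) => [[|k]|k] /=; rewrite ?unlift_none ?liftK /= ?E //.
Qed.

Lemma fo_or P Q : fo P -> fo Q -> fo (fun i e => P i e \/ Q i e).
Proof.
move=> /fo_not hP /fo_not hQ; apply: fo_ext (fo_not (fo_and hP hQ)) => i e.
by rewrite not_andE !notE.
Qed.

Lemma fo_imp P Q : fo P -> fo Q -> fo (fun i e => P i e -> Q i e).
Proof.
by move=> /fo_not hP hQ; apply: fo_ext (fo_or hP hQ) => i e; rewrite implyE.
Qed.

Lemma fo_all (P : forall i, (nat -> S i) -> S i -> Prop) :
  fo (fun i e => P i (fun k => e k.+1) (e 0)) ->
  fo (fun i e => forall x, P i e x).
Proof.
move=> h.
apply: fo_ext (fo_not (fo_ex (P := fun i e x => ~ P i e x) (fo_not h))) => i e.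
by rewrite -forallNE; split=> hP x; [apply: contrapT|move=> /(_ (hP x))].
Qed.

Lemma fo_var k : fo_term (fun i e => e k).
Proof.
exists 2%N, (FEq (TVar L ord0) (TVar L ord_max)).
by exists (fun j => if j == ord0 then inl k.+1 else inl 0%N) => i e /=.
Qed.

Lemma fo_cst a : fo_term (fun i e => cst a i).
Proof.
exists 2%N, (FEq (TVar L ord0) (TVar L ord_max)).
by exists (fun j => if j == ord0 then inr a else inl 0%N) => i e /=.
Qed.

(** P (t e) is equivalent to: there is x with t e = x and P x. *)
Lemma fo_subst (P : forall i, (nat -> S i) -> S i -> Prop) t :
  fo (fun i e => P i (fun k => e k.+1) (e 0)) -> fo_term t ->
  fo (fun i e => P i e (t i e)).
Proof.
move=> hP ht.
apply: fo_ext (fo_ex (P := fun i e x => t i e = x /\ P i e x) (fo_and ht hP)).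
by move=> i e; split => [[x [<-]]//|]; exists (t i e).
Qed.

Lemma fo_eq t u : fo_term t -> fo_term u -> fo (fun i e => t i e = u i e).
Proof. move=> ht hu; exact: (fo_subst (P := fun i e x => t i e = x)). Qed.

Lemma fo_lt t u : fo_term t -> fo_term u -> fo (fun i e => t i e < u i e).
Proof.
move=> ht hu; apply: (fo_subst (P := fun i e x => t i e < x)) => //.
apply: (fo_subst (P := fun i e x => x < e 0)
                 (t := fun i e => t i (fun k => e k.+1))).
  exists 2%N, (FLt (TVar L ord0) (TVar L ord_max)).
  by exists (fun j => if j == ord0 then inl 0%N else inl 1%N) => i e /=.
exact: (fo_ren (fun k => if k is k'.+1 then k'.+2 else 0%N) ht).
Qed.

Lemma fo_olt b t u : fo_term t -> fo_term u ->
  fo (fun i e => olt b (t i e) (u i e)).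
Proof. by case: b => ht hu; exact: fo_lt. Qed.

Lemma fo_ole b t u : fo_term t -> fo_term u ->
  fo (fun i e => ole b (t i e) (u i e)).
Proof.
move=> ht hu; apply: fo_ext (fo_not (fo_olt b hu ht)) => i e.
by case: b; rewrite /olt /ole leNgt; split => /negP.
Qed.

Lemma fo_app (F : forall i, S i -> S i) t :
  fo_term (fun i e => F i (e 0)) -> fo_term t ->
  fo_term (fun i e => F i (t i e)).
Proof.
move=> hF ht; apply: (fo_subst (P := fun i e x => F i x = e 0)
    (t := fun i e => t i (fun k => e k.+1))).
  exact: (fo_ren (fun k => match k with 0 => 1%N | 1 => 0%N | _ => k end) hF).
exact: (fo_ren (fun k => if k is k'.+1 then k'.+2 else 0%N) ht).
Qed.

Lemma fo_mem (A : forall i, S i -> Prop) t :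
  fo (fun i e => A i (e 0)) -> fo_term t -> fo (fun i e => A i (t i e)).
Proof. exact: (fo_subst (P := fun i e x => A i x)). Qed.

End FirstOrder.

Section TameDefinable.
Variables (L : language) (I : Type) (S : I -> structure L).
Variables (K : Type) (cst : K -> forall i, S i).
Variable P : forall i, (nat -> S i) -> S i -> Prop.
Hypothesis foP : fo cst (fun i e => P (fun k => e k.+1) (e 0)).

Let foP_shift r : fo cst (fun i e => P (fun k => e (r k)) (e 0)).
Proof. exact: (fo_ren (fun k => if k is k'.+1 then r k' else 0) foP). Qed.

Lemma fo_germ b t :
  fo_term cst t -> fo cst (fun i e => germ b (Some (t i e)) (P e)).
Proof.
move=> ht; apply: (fo_subst (P := fun i e p => germ b (Some p) (P e))) => //.
apply: fo_ext (fo_ex (P := fun i e y => olt b (e 0) y /\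
  forall x, olt b (e 0) x -> olt b x y -> P (fun k => e k.+1) x) _).
  by move=> i e; split=> [[x [? ?]]|[x ? ?]]; exists x.
by apply: fo_and; [|apply: fo_all; do !apply: fo_imp => //];
  do ?[apply: fo_olt; apply: fo_var].
Qed.

Lemma fo_germ_infty b : fo cst (fun i e => germ b None (P e)).
Proof.
apply: fo_ext (fo_ex (P := fun i e y => forall x, olt b x y -> P e x) _).
  move=> i e; split=> [[x h]|[x _ h]]; exists x => // y; [move=> _|];
    exact: h.
by apply: fo_all; apply: fo_imp => //; apply: fo_olt; apply: fo_var.
Qed.

End TameDefinable.

Lemma fo_tame (L : language) (I : Type) (S : I -> structure L) (K : Type)
    (cst : K -> forall i, S i) (P : forall i, (nat -> S i) -> S i -> Prop) b :
  fo cst (fun i e => P i (fun k => e k.+1) (e 0)) ->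
  fo cst (fun i e => tame b (P i e)).
Proof.
move=> foP.
have foP_shift r : fo cst (fun i e => P i (fun k => e (r k)) (e 0)).
  exact: (fo_ren (fun k => if k is k'.+1 then r k' else 0) foP).
apply: (@fo_ext _ _ _ _ _ (fun i e =>
  (forall c, germ_decided b (Some c) (P i e)) /\
  (germ_decided b None (P i e) /\
   ((exists x, P i e x) -> (exists u, forall x, P i e x -> ole b x u) ->
    exists s, is_lub b (P i e) s)))).
  by move=> i e; split=> [[? []]|[]].
apply: fo_and; [|apply: fo_and].
- apply: fo_all; apply: fo_or; apply: (fo_germ (P := fun i e x => _));
    by do ?apply: fo_not; do ?apply: fo_var.
- apply: fo_or; apply: (fo_germ_infty (P := fun i e x => _));
    by do ?apply: fo_not.
have fo_bound : fo cst (fun i e => forall x, P i (fun k => e k.+1) x ->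
    ole b x (e 0)).
  by apply: fo_all; apply: fo_imp => //; apply: fo_ole; apply: fo_var.
apply: fo_imp; first exact: fo_ex.
apply: fo_imp; first exact: fo_ex.
apply: fo_ex; apply: fo_and => //.
apply: fo_all; apply: fo_imp; first by apply: fo_olt; apply: fo_var.
by apply: fo_ex; apply: fo_and => //; apply: fo_olt; apply: fo_var.
Qed.

(** * Tame sets and o-minimality *)

Section TameSets.
Variables (L : language) (M : structure L).
Implicit Types (b : bool) (x y z : M) (p : option M).

(** A convex set that meets every neighbourhood of a place contains the points
    between this place and any of its own points beyond it. *)
Lemma tame_convex b (A : set M) : order_convex A ->
  ((exists x, A x) -> (exists u, forall x, A x -> ole b x u) ->
   exists s, is_lub b A s) ->
  tame b A.
Proof.
move=> cA lubA; suff h p : germ_decided b p A by split.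
case: (pselect (exists2 x, after b p x & A x)) => [[x0 px0 Ax0]|nA]; last first.
  right; have [y py] := after_nonempty b p; exists y => // x px _ Ax.
  by apply: nA; exists x.
case: (pselect (germ b p (fun x => ~ A x))) => [|ng]; [by right|left].
exists x0 => // y py yx0; apply: contrapT => nAy; apply: ng.
exists y => // x px xy Ax; apply: nAy; move: xy yx0.
by case: b {lubA py px px0} => /ltW xy /ltW yx0;
  [apply: (cA x x0)|apply: (cA x0 x)] => //; rewrite xy yx0.
Qed.

Lemma tame_set1 b x : tame b [set x].
Proof.
apply: tame_convex => [_ _ z -> ->|_ _]; first by move=> /le_anti.
exists x; split => [_ ->|t tx]; last by exists x.
by rewrite oleNgt oltxx.
Qed.

(** The least bound, in the direction b, of a nonempty bounded open interval is
    its endpoint on that side. *)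
Lemma tame_itv b (i : interval M) : itv_open_ends i -> tame b [set` i].
Proof.
case: i => l r oi; apply: tame_convex => [x y z /=|[x xi] [u ub]].
  rewrite !itv_boundlr => /andP[lx _] /andP[_ yr] /andP[xz zy].
  by rewrite (le_trans lx) ?(le_trans _ yr) ?bnd_simp.
(* The endpoint e on the side of the direction b is None if the interval is
   unbounded there. *)
have [e [ie ei]] : exists e,
    (forall y, y \in Interval l r -> after (~~ b) e y) /\
    (forall y, olt b x y -> after (~~ b) e y -> y \in Interval l r).
  move: xi oi {ub}; case: l => [[] l|[]]; case: r => [[] r|[]] //=;
    rewrite in_itv /= ?andbT => xi _.
  - exists (Some (if b then r else l)); case/andP: xi => lx xr.
    by case: b; rewrite /= /olt;
      (split=> y; [rewrite in_itv /= => /andP[]//|]) => h1 h2;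
      rewrite in_itv /= ?h2 ?(lt_trans lx) ?(lt_trans _ xr).
  - exists (if b then None else Some l).
    case: b; rewrite /= /olt;
      (split=> y; [rewrite in_itv /= ?andbT //|]) => h1 h2;
      by rewrite in_itv /= ?h2 ?(lt_trans xi).
  - exists (if b then Some r else None).
    case: b; rewrite /= /olt;
      (split=> y; [rewrite in_itv /= ?andbT //|]) => h1 h2;
      by rewrite in_itv /= ?h2 ?(lt_trans _ xi).
  - by exists None.
case: e ie ei => [s|] ie ei; last first.
  have [y uy] := olt_unbounded b (omin (~~ b) x u).
  have := uy; rewrite -oltN olt_omin !oltN => /andP[xy uy'].
  by have := ub y (ei y xy isT); rewrite oleNgt uy'.
exists s; split=> [y /ie|t ts]; first by rewrite /= oltN; exact: oltW.
have xs : olt b x s by have := ie _ xi; rewrite /= oltN.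
have [z] : exists2 z, olt b (omin (~~ b) x t) z & olt b z s.
  by apply: olt_dense; rewrite /omin; case: ifP.
rewrite -oltN olt_omin !oltN => /andP[xz tz] zs.
by exists z; split=> //; apply: ei => //=; rewrite oltN.
Qed.

(** Germs intersect, and the least bound of a union is one of the two least
    bounds. *)
Lemma tame_setU b (A B : set M) : tame b A -> tame b B -> tame b (A `|` B).
Proof.
move=> [A1 A2 A3] [B1 B2 B3].
have U p : germ_decided b p A -> germ_decided b p B ->
    germ_decided b p (A `|` B).
  move=> [hA|hA]; first by left; apply: germS hA => x; left.
  move=> [hB|hB]; first by left; apply: germS hB => x; right.
  by right; apply: germS (germI hA hB) => x [? ?] [].
split => [c||[x ABx] [u ub]]; [exact: U|exact: U|].
case: (pselect (exists x, A x)) => [Ax|nA]; last first.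
  suff -> : A `|` B = B
    by apply: B3; [case: ABx => h; exists x => //; case: nA; exists x
                                    |exists u => y By; apply: ub; right].
  by apply/seteqP; split=> y; [case=> // Ay; case: nA; exists y|right].
case: (pselect (exists x, B x)) => [Bx|nB]; last first.
  suff -> : A `|` B = A by apply: A3 => //; exists u => y By; apply: ub; left.
  by apply/seteqP; split=> y; [case=> // Ay; case: nB; exists y|left].
have [||s [s1 s2]] := A3 => //; first by exists u => y By; apply: ub; left.
have [||t [t1 t2]] := B3 => //; first by exists u => y By; apply: ub; right.
case: (boolP (olt b s t)) => [st|].
  exists t; split=> [y [/s1 ys|/t1//]|z /t2[y [By zy]]];
    last by exists y; split=> //; right.
  exact/oltW/(ole_lt_trans ys).
rewrite -oleNgt => ts.
exists s; split=> [y [/s1//|/t1 yt]|z /s2[y [By zy]]];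
  last by exists y; split=> //; left.
by case: (ole_eqVlt yt) => [->//|/olt_le_trans h]; exact/oltW/h.
Qed.

Lemma o_minimal_tame b (A : set M) : o_minimal M -> definable_set A -> tame b A.
Proof.
move=> omin /omin[F [/finite_seqP[s ->] hF ->]] {A}.
elim: s hF => [|B s IH] hF.
  rewrite set_nil bigcup_set0; apply: tame_convex => //.
  by case.
have -> : \bigcup_(C in [set` B :: s]) C = B `|` \bigcup_(C in [set` s]) C.
  apply/seteqP; split=> x.
    by move=> [C /=]; rewrite inE => /orP[/eqP->|Cs Cx]; [left|right; exists C].
  move=> [Bx|[C Cs Cx]]; first by exists B; rewrite //= inE eqxx.
  by exists C; rewrite //= inE Cs orbT.
apply: tame_setU; last by apply: IH => C Cs; apply: hF; rewrite /= inE Cs orbT.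
have [|[x ->]|[i [oi ->]]] := hF B; rewrite /= ?inE ?eqxx //.
  exact: tame_set1.
exact: tame_itv.
Qed.

End TameSets.

Section Transfer.
Variable L : language.

Let fo_uniform := @fo L (structure L) id void (fun k _ => match k with end).

(** The universal closure of a formula for P is a sentence true in all o-minimal
    structures. *)
Lemma o_minimalistic_transfer (P : forall N : structure L, (nat -> N) -> Prop)
    (M : structure L) :
  o_minimalistic M -> fo_uniform P ->
  (forall N : structure L, o_minimal N -> forall e, P N e) -> forall e, P M e.
Proof.
move=> hM [n [phi [v h]]] hP e.
(* The formula is put over the variables 0, ..., m-1, in the order of the
   environment, before closing it. *)
pose v' j : nat := if v j is inl k then k else 0%N.
pose m := (\max_(j < n) v' j).+1.
have vE (N : structure L) (f : nat -> N) : P N f <->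
    sat (ren phi (fun j => inord (v' j) : 'I_m)) (fun j : 'I_m => f j).
  rewrite h sat_ren; set e1 := (X in sat _ X); set e2 := (X in _ <-> sat _ X).
  suff -> : e1 = e2 by [].
  apply: funext => j; rewrite /e1 /e2 inordK;
    last by rewrite /m ltnS; exact: leq_bigmax.
  by rewrite /v'; case: (v j).
apply/vE; move: (fun j : 'I_m => e j).
apply/holds_closure_all/hM => N oN; apply/holds_closure_all => f.
have [a] := univ_inhabited N.
pose g k := if insub k is Some j then f j else a.
suff -> : f = fun j : 'I_m => g j by apply/vE/hP.
by apply: funext => j; rewrite /g valK.
Qed.

(** The parameters of A are quantified universally: for the formula defining A,
    tameness of all the sets it defines is a first-order property. *)
Lemma o_minimalistic_tame (M : structure L) b (A : set M) :
  o_minimalistic M -> definable_set A -> tame b A.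
Proof.
move=> hM [m [phi [a]]] EA.
pose con (S : structure L) (x : S) (e : nat -> S) k :=
  if k is k'.+1 then e k' else x.
pose B (S : structure L) (e : nat -> S) (x : S) :=
  sat phi (fun j : 'I_(1 + m) => con S x e j).
have conE (S : structure L) (x : 'I_1 -> S) (f : 'I_m -> S) (e : nat -> S) :
    (forall j : 'I_m, e j = f j) ->
    (fun j : 'I_(1 + m) => con S (x ord0) e j) =
    (fun i => match fintype.split i with inl j => x j | inr k => f k end).
  move=> ef; apply: funext => j; case: splitP => k E; rewrite E /= ?ef //.
  by rewrite (ord1 k).
have [x0] := univ_inhabited M.
pose e k := if insub k is Some j then a j else x0.
have -> : A = B M e.
  apply: funext => x.
  have := congr1 (fun Z => Z (fun _ => x)) EA; rewrite /= => ->.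
  by rewrite /B -(conE M (fun=> x) a e) // => j; rewrite /e valK.
apply: (o_minimalistic_transfer (P := fun S e => tame b (B S e))) => //.
  apply: fo_tame; exists (1 + m)%N, phi, (fun j => inl (j : nat)) => S f.
  rewrite /B; suff -> : (fun j : 'I_(1 + m) => con S (f 0) (fun k => f k.+1) j) =
      (fun j => f j) by [].
  by apply: funext => -[[|k] hk].
move=> N oN f; apply: o_minimal_tame => //.
exists m, phi, (fun j => f j); apply: funext => x /=.
by rewrite /B (conE N x (fun j => f j)).
Qed.

End Transfer.

(** * Definability in a fixed structure *)

Section InStructure.
Variables (L : language) (M : structure L).

(** First-order predicates with parameters in M: the family consists of M alone
    and its points are the constants. *)
Definition fo_pred (P : (nat -> M) -> Prop) : Prop :=
  @fo L unit (fun _ => M) M (fun a _ => a) (fun _ => P).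

Definition fo_fun (t : (nat -> M) -> M) : Prop :=
  @fo_term L unit (fun _ => M) M (fun a _ => a) (fun _ => t).

Definition def_set (A : M -> Prop) : Prop := fo_pred (fun e => A (e 0)).

Definition def_fun (F : M -> M) : Prop := fo_pred (fun e => F (e 1%N) = e 0).

Lemma fo_pred_definable n (A : set ('I_n -> M)) (k : 'I_n -> nat) :
  definable A -> fo_pred (fun e => A (fun i => e (k i))).
Proof.
move=> [m [phi [a ->]]]; exists (n + m)%N, phi.
exists (fun j =>
  match fintype.split j with inl i => inl (k i) | inr i => inr (a i) end).
move=> [] e /=; set e1 := (X in sat _ X); set e2 := (X in _ <-> sat _ X).
suff -> : e1 = e2 by [].
by apply: funext => j; rewrite /e1 /e2; case: (fintype.split j).
Qed.

(** A predicate of e 0 has the same value at e and at the constant environment e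
    0, where the formula has a single free variable besides the parameters. *)
Lemma def_setP (A : set M) : definable_set A <-> def_set A.
Proof.
split=> [/(fo_pred_definable (fun=> 0%N))//|[m [phi [v h]]]].
have [x0] := univ_inhabited M.
exists m.
exists (ren phi (fun j => if v j is inl _ then lshift m ord0 else rshift 1 j)).
exists (fun j => if v j is inr a then a else x0).
apply: funext => x /=; apply: propext.
have := h tt (fun=> x ord0); rewrite /= => ->; rewrite sat_ren.
set e1 := (X in sat _ X); set e2 := (X in _ <-> sat _ X).
suff -> : e1 = e2 by [].
apply: funext => j; rewrite /e1 /e2; case E: (v j) => [i|a] /=.
  by rewrite (unsplitK (inl _)).
by rewrite (unsplitK (inr _)) E.
Qed.

Lemma fo_pred_app F t : def_fun F -> fo_fun t ->
  fo_fun (fun e => F (t e)).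
Proof. exact: (fo_app (F := fun _ => F)). Qed.

Lemma fo_pred_mem A t : def_set A -> fo_fun t ->
  fo_pred (fun e => A (t e)).
Proof. exact: (fo_mem (A := fun _ => A)). Qed.

Lemma fo_after b p (t : (nat -> M) -> M) : fo_fun t ->
  fo_pred (fun e => after b p (t e)).
Proof.
move=> ht; case: p => [c|]; first by apply: fo_olt => //; exact: (fo_cst _ c).
by apply: fo_ext (fo_eq ht ht).
Qed.

End InStructure.

Ltac fo_step :=
  lazymatch goal with
  | |- fo _ (fun i e => ~ @?P i e) => apply: fo_not
  | |- fo _ (fun i e => @?P i e /\ @?Q i e) => apply: fo_and
  | |- fo _ (fun i e => @?P i e \/ @?Q i e) => apply: fo_or
  | |- fo _ (fun i e => exists x, @?P i e x) => apply: fo_ex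
  | |- fo _ (fun i e => is_true (after _ _ (@?t i e))) => apply: fo_after
  | |- fo _ (fun i e => is_true (olt _ (@?t i e) (@?u i e))) => apply: fo_olt
  | |- fo _ (fun i e => is_true (ole _ (@?t i e) (@?u i e))) => apply: fo_ole
  | |- fo _ (fun i e => is_true (@Order.lt _ _ (@?t i e) (@?u i e))) => apply: fo_lt
  | |- fo _ (fun i e => @?t i e = @?u i e) => apply: fo_eq
  | |- fo _ (fun i e => germ _ (Some (@?t i e)) (@?P i e)) => apply: fo_germ
  | |- fo _ (fun i e => germ _ None (@?P i e)) => apply: fo_germ_infty
  | |- fo _ (fun i e => @?P i e -> @?Q i e) => apply: fo_imp
  | |- fo _ (fun i e => forall x, @?P i e x) => apply: fo_all
  | |- fo_term _ (fun i e => e _) => exact: fo_var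
  | H : def_fun ?F |- fo_term _ (fun i e => ?F (@?t i e)) =>
      let u := eval cbv beta in (t tt) in refine (fo_pred_app (t := u) H _)
  | H : def_set ?A |- fo _ (fun i e => ?A (@?t i e)) =>
      let u := eval cbv beta in (t tt) in refine (fo_pred_mem (t := u) H _)
  | |- fo_term ?K (fun i e => ?a) => exact: (fo_cst K a)
  end.
(** Descends through the logical structure of a predicate down to variables,
    parameters and the definable sets and maps in the context. *)
Ltac definability := do ?(rewrite ?/def_set ?/fo_pred ?/fo_fun; cbv beta; fo_step).

Section Tame.
Variables (L : language) (M : structure L).
Hypothesis hM : o_minimalistic M.
Implicit Types (b : bool) (p : option M) (A : M -> Prop) (F : M -> M).

Lemma germ_decide b p A : def_set A -> germ b p A \/ germ b p (fun x => ~ A x).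
Proof.
move=> /def_setP /(o_minimalistic_tame b hM)[h1 h2 _].
by case: p => [c|]; [exact: h1|exact: h2].
Qed.

Lemma germ_complete b p A : def_set A -> ~ germ b p A ->
  germ b p (fun x => ~ A x).
Proof. by case/(germ_decide b p). Qed.

Lemma def_set_lub b A : def_set A -> (exists x, A x) ->
  (exists u, forall x, A x -> ole b x u) -> exists s, is_lub b A s.
Proof. by move=> /def_setP /(o_minimalistic_tame b hM)[_ _]. Qed.

(** This replaces induction along the line and is, apart from the existence of
    limits, the only use of least bounds: s is the least bound of the points up
    to which A holds. If A holds at s too, the germ dichotomy leaves only the
    possibility that it fails immediately after s. *)
Lemma first_exit b p A z : def_set A -> germ b p A -> after b p z -> ~ A z ->
  exists s, [/\ after b p s, ole b s z,
                forall x, after b p x -> olt b x s -> A x &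
                ~ A s \/ germ b (Some s) (fun x => ~ A x)].
Proof.
move=> dA [y0 py0 hy0] pz nAz.
pose B y := after b p y /\ forall x, after b p x -> ole b x y -> A x.
have dB : def_set B by rewrite /B; definability.
have [z0 pz0 z0y0] := after_dense py0.
have Bz0 : B z0.
  by split=> // x px xz0; apply: hy0 => //; exact: ole_lt_trans z0y0.
have ltBz y : B y -> olt b y z.
  move=> [_ hy]; apply: contrapT => /negP; rewrite -oleNgt => zy.
  exact/nAz/hy.
have [||s [s1 s2]] := def_set_lub (b := b) dB; first by exists z0.
  by exists z => y /ltBz/oltW.
have ps : after b p s.
  by have := s1 _ Bz0 => /ole_eqVlt[<-//|]; exact: after_trans.
have sA x : after b p x -> olt b x s -> A x.
  by move=> px /s2[y [[_ By] xy]]; apply: By => //; exact: oltW.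
exists s; split=> //.
  rewrite oleNgt; apply/negP => /s2[y [/ltBz yz zy]].
  by have := olt_trans yz zy; rewrite oltxx.
case: (pselect (A s)) => [As|]; [right|by left].
have [[y /= sy hy]|//] := germ_decide b (Some s) dA.
have [z' sz' z'y] := olt_dense sy.
suff /s1 : B z' by rewrite oleNgt sz'.
split=> [|x px xz']; first exact: after_trans sz'.
have [xs|->//|sx] := olt_total b x s; first exact: sA.
by apply: hy => //; exact: ole_lt_trans z'y.
Qed.

(** A place is sent by F to a constant or to a place. The image is found as the
    least bound s of the values that F eventually exceeds: F is eventually equal
    to s, or eventually close to it on one side; s is infinite when there is no
    such value, or no bound on them. *)
Lemma germ_push b p F : def_fun F ->
  (exists d, germ b p (fun x => F x = d)) \/
  (exists b' p', forall P : M -> Prop, germ b' p' P ->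
     germ b p (fun x => P (F x))).
Proof.
move=> dF; pose U y := germ b p (fun x => olt true y (F x)).
have dU : def_set U.
  by rewrite /U; case: (p) => [c|]; definability.
have nU y y' : ~ U y -> olt true y y' -> germ b p (fun x => olt true (F x) y').
  move=> nUy yy'; apply: germS (germ_complete _ nUy) => [x|];
    last by definability.
  by move=> /negP; rewrite -oleNgt => h; exact: ole_lt_trans yy'.
case: (pselect (exists y, U y)) => [Uy|/forallNP nUy]; last first.
  right; exists true, None => P [y _ hy].
  have [y'] := olt_unbounded false y; rewrite (oltN true) => y'y.
  by apply: germS (nU _ _ (nUy y') y'y) => x; exact: hy.
case: (pselect (exists u, forall x, U x -> ole true x u))
  => [Uu|/forallNP nUu]; last first.
  right; exists false, None => P [y _ hy].
  have [z /not_implyP[Uz /negP]] := (existsNP _).2 (nUu y).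
  rewrite oleNgt negbK => yz; apply: germS Uz => x zFx.
  by apply: hy => //; rewrite (oltN true); exact: olt_trans zFx.
have [s [s1 s2]] := def_set_lub dU Uy Uu.
have d1 : def_set (fun x => F x = s) by definability.
have d2 : def_set (fun x => olt true s (F x)) by definability.
have [h1|h1] := germ_decide b p d1; first by left; exists s.
right; have [h2|h2] := germ_decide b p d2.
  exists true, (Some s) => P [y /= sy hy].
  have [y' sy' y'y] := olt_dense sy.
  have nUy' : ~ U y' by move=> /s1; rewrite oleNgt sy'.
  by apply: germS (germI h2 (nU _ _ nUy' y'y)) => x [? ?]; exact: hy.
exists false, (Some s) => P [y /=]; rewrite (oltN true) => /s2[y' [Uy' yy']] hy.
apply: germS (germI (germI h1 h2) Uy') => x [[n1 /negP n2] y'F].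
apply: hy; rewrite (oltN true); last exact: olt_trans y'F.
by case: (olt_total true s (F x)) => // [|E]; [rewrite (negbTE n2)|case: n1].
Qed.

Definition no_interior A := forall x y, x < y -> exists2 z, x < z < y & ~ A z.

Lemma no_interior_germ A b p : def_set A -> no_interior A ->
  germ b p (fun x => ~ A x).
Proof.
move=> dA nA; apply: germ_complete => // -[y py hy].
have [x px xy] := after_dense py.
have [z] : exists2 z, olt b x z && olt b z y & ~ A z.
  by case: b xy {hy py px}; rewrite /olt => /nA[z /andP[h1 h2]];
      exists z; rewrite ?h1 ?h2.
by move=> /andP[xz zy]; apply; apply: hy => //; exact: after_trans xz.
Qed.

(** Every place avoids A, so F can only send (b, p) to a point of A. *)
Lemma germ_into_no_interior b p F A : def_fun F -> def_set A -> no_interior A ->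
  germ b p (fun x => A (F x)) -> exists d, germ b p (fun x => F x = d).
Proof.
move=> dF dA nA AF; case: (germ_push b p dF) => // -[b' [p' h]].
case: (germ_disjoint AF (h _ (no_interior_germ b' p' dA nA))).
Qed.

(** The three kinds of monotonicity: constant, increasing, decreasing. *)
Definition rel_of (t : option bool) (x y : M) : Prop :=
  if t is Some s then olt s x y else x = y.

Lemma rel_of_trans t y x z : rel_of t x y -> rel_of t y z -> rel_of t x z.
Proof. by case: t => [s|]; [exact: olt_trans|move=> /= ->]. Qed.

Lemma rel_of_inj t t' x y : rel_of t x y -> rel_of t' x y -> t = t'.
Proof.
case: t t' => [[]|] [[]|] //=; try (by move=> + E; rewrite E oltxx);
  try (by move=> ->; rewrite oltxx).
- by move=> xy /olt_trans/(_ xy); rewrite oltxx.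
- by move=> xy /olt_trans/(_ xy); rewrite oltxx.
Qed.

Lemma fo_rel t u v : fo_fun u -> fo_fun v ->
  fo_pred (fun e => rel_of t (u e) (v e)).
Proof. by case: t => [s|]; [exact: fo_olt|exact: fo_eq]. Qed.

(** The set of z such that F x and F z are related contains the first point s
    where it could stop, because F s is related to the values just before s; and
    then it does not stop, because of the values just after s. *)
Lemma local_to_global t F x y : def_fun F -> x < y ->
  (forall z, x <= z < y ->
    germ true (Some z) (fun w => rel_of t (F z) (F w))) ->
  (forall z, x < z <= y ->
    germ false (Some z) (fun w => rel_of t (F w) (F z))) ->
  rel_of t (F x) (F y).
Proof.
move=> dF xy hr hl; apply: contrapT => nR.
pose A z := rel_of t (F x) (F z).
have dA : def_set A by apply: fo_rel; definability.
have [|s [/= xs sy sA h]] := first_exit (b := true) (p := Some x) dA _ xy nR.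
  by apply: hr; rewrite lexx.
have As : A s.
  have hs : germ false (Some s) (fun w => rel_of t (F w) (F s)).
    by apply: hl; apply/andP; split.
  have xs' : olt false s x by exact: xs.
  have [w _ [[ws xw] wR]] := germ_ex (germI (germ_itv xs') hs).
  by apply: rel_of_trans wR; apply: sA.
case: h => // h.
have {}sy : s < y.
  by rewrite lt_neqAle; apply/andP; split=> //; apply/eqP => E; apply: nR; rewrite -E.
have hs : germ true (Some s) (fun w => rel_of t (F s) (F w)).
  by apply: hr; rewrite sy andbT ltW.
apply: (germ_disjoint hs); apply: germS h => w nAw R; apply: nAw.
exact: rel_of_trans R.
Qed.

End Tame.

(** * Monotonicity *)

Section Monotone.
Variables (L : language) (M : structure L).
Hypothesis hM : o_minimalistic M.
Implicit Types (b s : bool) (A Y : M -> Prop) (F : M -> M).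

(** The inequality before x is weak because it arises as the failure of F < v.
    No point drops in both directions even so ([no_strict_extrema]). *)
Definition drops b s F x := exists v,
  germ b (Some x) (fun y => olt s (F y) v) /\
  germ (~~ b) (Some x) (fun y => ole s v (F y)).

Definition strict_extremum s F x :=
  forall b, germ b (Some x) (fun y => olt s (F x) (F y)).

(** Read with b and s true, so that all points are strict local minima. Close to
    q no x has its value below all later ones: otherwise F would be
    nondecreasing there, against the left germs. So every c has a later smaller
    value, and then F < F c close to q: otherwise F >= F c close to q, and,
    going back from q, this first fails at a point t after c, not just before it
    as t is a local minimum; then F t is below all later values. But F > F c
    right after c, so F stays below F c only from some later point t on; this t
    cannot have F t >= F c, being a local minimum followed by values below F c,
    so F is at least F c just before t, and t drops. Points that drop are thus
    found arbitrarily close to q, and the germ dichotomy concludes. *)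
Lemma strict_extrema_drops b s F p q : def_fun F -> olt b p q ->
  (forall x, olt b p x -> olt b x q -> strict_extremum s F x) ->
  exists2 p', ole b p p' /\ olt b p' q &
    forall x, olt b p' x -> olt b x q -> drops b s F x.
Proof.
move=> dF pq ext.
have qp : after (~~ b) (Some q) p by rewrite /= oltN.
pose B x := forall y, olt b x y -> olt b y q -> ole s (F x) (F y).
have dB : def_set B by rewrite /B; definability.
have [[y0 qy0 hB]|[y0 qy0 hB]] := germ_decide hM (~~ b) (Some q) dB.
  have qy1 : after (~~ b) (Some q) (omin (~~ b) y0 p) by exact: after_omin.
  have [y qy yy1] := after_dense qy1.
  move: yy1; rewrite olt_omin => /andP[yy0 yp].
  have ey : strict_extremum s F y by apply: ext; rewrite -oltN.
  have [x _ [yx [/= hx1 hx2]]] := germ_ex (germI (ey (~~ b)) (germ_itv yy0)).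
  have /hB : olt (~~ b) q x by exact: olt_trans hx1.
  move=> /(_ hx2 y); rewrite -oltN => /(_ hx1); rewrite -oltN => /(_ qy).
  by rewrite oleNgt yx.
(* From e to q no point has its value below all later ones. *)
pose e := omin (~~ b) y0 p.
have {}qe : olt b e q by rewrite -oltN; exact: (after_omin qy0 qp).
have below c : olt b e c -> olt b c q ->
    exists y, [/\ olt b c y, olt b y q & olt s (F y) (F c)].
  rewrite -oltN olt_omin => /andP[cy0 _] cq.
  have := hB c; rewrite /= oltN => /(_ cq cy0).
  by move=> /existsNP[y /not_implyP[cy /not_implyP[yq /negP]]];
    rewrite oleNgt negbK; exists y.
have epx c : olt b e c -> olt b p c by rewrite -oltN olt_omin !oltN => /andP[].
have evc c : olt b e c -> olt b c q ->
    germ (~~ b) (Some q) (fun x => olt s (F x) (F c)).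
  move=> ec cq.
  pose A x := ole s (F c) (F x).
  have dA : def_set A by rewrite /A; definability.
  have [hA|hA] := germ_decide hM (~~ b) (Some q) dA; last first.
    by apply: germS hA => x /negP; rewrite /A oleNgt negbK.
  have [y [cy yq Fyc]] := below c ec cq.
  have [||t [/= qt ty tA h]] := first_exit hM (z := y) dA hA.
  - by rewrite /= oltN.
  - by apply/negP; rewrite /A oleNgt negbK.
  rewrite oltN in qt.
  have ct : olt b c t.
    by apply: (olt_le_trans cy); move: ty; rewrite !oleNgt oltN.
  have et := olt_trans ec ct.
  have At : A t.
    apply: contrapT => /negP; rewrite /A oleNgt negbK => Ftc.
    have [z [tz zq]] := below t et qt.
    have : A z by apply: tA; rewrite oltN.
    by rewrite /A => /(olt_le_trans Ftc) /olt_trans h' /h'; rewrite oltxx.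
  case: h => // h.
  have [x _ [tx]] := germ_ex (germI (ext t (epx t et) qt (~~ b)) h).
  by case; apply/oltW/(ole_lt_trans At).
have dropc c : olt b e c -> olt b c q ->
    exists t, [/\ olt b c t, olt b t q & drops b s F t].
  move=> ec cq.
  pose A x := olt s (F x) (F c).
  have dA : def_set A by rewrite /A; definability.
  have [z _ [[cz zq] Fcz]] :=
    germ_ex (germI (germ_itv cq) (ext c (epx c ec) cq b)).
  have [||t [/= qt tz tA h]] := first_exit hM (z := z) dA (evc c ec cq).
  - by rewrite /= oltN.
  - by move=> /olt_trans/(_ Fcz); rewrite oltxx.
  rewrite oltN in qt.
  have ct : olt b c t.
    by apply: (olt_le_trans cz); move: tz; rewrite !oleNgt oltN.
  have Agt : germ b (Some t) A.
    by exists q => // x /= tx xq; apply: tA; rewrite oltN.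
  have At : A t.
    have [x _ [Ax tx]] :=
      germ_ex (germI Agt (ext t (epx t (olt_trans ec ct)) qt b)).
    exact: olt_trans Ax.
  exists t; split=> //; exists (F c); split=> //; case: h => // h.
  by apply: germS h => x /negP; rewrite oleNgt.
have dD : def_set (drops b s F) by rewrite /drops; definability.
have [[y1 /= qy1 h]|[y1 /= qy1 h]] := germ_decide hM (~~ b) (Some q) dD.
  exists (omin (~~ b) y1 p).
    split; last first.
      have := after_omin (qy1 : after (~~ b) (Some q) y1) qp.
      by rewrite /= oltN.
    by rewrite /omin oltN; case: ifP => [/oltW|] //; rewrite oleNgt oltxx.
  move=> x; rewrite -oltN olt_omin => /andP[xy _] xq; apply: h => //=.
  by rewrite oltN.
have : after (~~ b) (Some q) (omin (~~ b) y1 e).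
  by apply: after_omin => //=; rewrite oltN.
move=> /after_dense[c /= qc]; rewrite olt_omin !oltN => /andP[yc ec].
rewrite oltN in qc.
have [t [ct tq Dt]] := dropc c ec qc.
case: (h t) => //; rewrite oltN //; exact: olt_trans ct.
Qed.

(** Applied in both directions, the previous lemma yields a point that drops in
    both: v <= F < w on one side and w <= F < v on the other. *)
Lemma no_strict_extrema s F p q : def_fun F -> p < q ->
  ~ (forall x, p < x -> x < q -> strict_extremum s F x).
Proof.
move=> dF pq ext.
have [p' [pp' p'q] hd] := strict_extrema_drops (b := true) dF pq ext.
have [|q' [qq' q'p'] hu] :=
    strict_extrema_drops (b := false) (p := q) (q := p') dF p'q (s := s).
  by move=> x xq p'x; apply: ext => //; exact: (ole_lt_trans (b := true) pp').
have [x q'x xp'] := olt_dense q'p'.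
have [v [v1 v2]] : drops true s F x.
  by apply: hd => //; apply: (ole_lt_trans (b := false) qq').
have [w [w1 w2]] := hu x q'x xp'.
(* F y lies in [w, v[ on the right of x, F z in [v, w[ on the left, for the
   order s. *)
have [y _ [y1 y2]] := germ_ex (germI v1 w2).
have [z _ [z1 z2]] := germ_ex (germI v2 w1).
have := olt_trans (ole_lt_trans y2 y1) (ole_lt_trans z1 z2).
by rewrite oltxx.
Qed.

Definition rel_monotone t F x y :=
  forall u v, x < u -> u < v -> v < y -> rel_of t (F u) (F v).

Lemma germ_inside b u x y : x < u -> u < y ->
  germ b (Some u) (fun w : M => x < w /\ w < y).
Proof.
by case: b => xu uy; [exists y|exists x] => //= w; rewrite /olt => h1 h2;
  split=> //; [exact: lt_trans h1|exact: lt_trans uy].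
Qed.

Lemma germ_interval b u x y (P : M -> Prop) :
  x < u -> u < y -> germ b (Some u) P ->
  exists x' y', [/\ x <= x', x' < y', y' <= y &
                    forall w, x' < w -> w < y' -> P w].
Proof.
move=> xu uy /(germI (germ_inside b xu uy)) [d /olt_dense[m um md] h].
have [[xm my] _] := h m um md.
case: b um md h => um md h; [exists u, m|exists m, u]; split;
    rewrite ?ltW // => w h1 h2.
  by apply: (h w h1 _).2; exact: (olt_trans (b := true) h2).
by apply: (h w h2 _).2; exact: (olt_trans (b := false) h1).
Qed.

(** The comparison of F near u with F u on the side b is an equality for some u,
    and F is constant near u on that side, or it is strict, of a kind that the
    germ dichotomy at x makes uniform in u close to x. *)
Lemma locally_monotone F x y : def_fun F -> x < y ->
  exists t x' y', [/\ x <= x', x' < y', y' <= y & rel_monotone t F x' y'].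
Proof.
move=> dF xy.
case: (pselect (exists u b, [/\ x < u, u < y &
    germ b (Some u) (fun w => F w = F u)])).
  move=> [u [b [xu uy /(germ_interval xu uy)[x' [y' [xx' x'y' y'y h]]]]]].
  exists None, x', y'; split=> // v w x'v vw wy' /=.
  by rewrite !h //; [exact: lt_trans vw|exact: lt_trans wy'].
move=> nconst.
pose R b s u := germ b (Some u) (fun w => olt s (F u) (F w)).
have dR b s : def_set (R b s) by rewrite /R; definability.
have RP u b : x < u -> u < y -> R b true u \/ R b false u.
  move=> xu uy.
  have d1 : def_set (fun w => F w = F u) by definability.
  have d2 : def_set (fun w => olt true (F u) (F w)) by definability.
  have [h1|h1] := germ_decide hM b (Some u) d1.
    by case: nconst; exists u, b.
  have [h2|h2] := germ_decide hM b (Some u) d2; [by left|right].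
  apply: germS (germI h1 h2) => w [n1 n2].
  by case: (olt_total true (F u) (F w)) => // E; case: n1.
have xxy : germ true (Some x) (fun w => x < w /\ w < y) by exact: germ_itv.
have pick b : exists s, germ true (Some x) (R b s).
  have [h|h] := germ_decide hM true (Some x) (dR b true); first by exists true.
  exists false; apply: germS (germI xxy h) => w [[xw wy] nR].
  by case: (RP w b xw wy).
have [s hs] := pick true; have [s' hs'] := pick false.
have [d xd h] := germI xxy (germI hs hs').
have [y' xy' y'd] := olt_dense xd.
have [[_ y'y] _] := h y' xy' y'd.
have {}h w : x < w -> w < y' -> R true s w /\ R false s' w.
  by move=> xw wy'; apply: (h w xw _).2; exact: lt_trans y'd.
case: (eqVneq s' s) => [ss'|].
  case: (no_strict_extrema (s := s) dF xy') => w xw wy' b.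
  by case: (h w xw wy'); rewrite ss'; case: b.
move=> ss'; have {ss'}s'E : s' = ~~ s by case: s s' ss' {hs hs' h} => -[].
exists (Some s), x, y'; split=> //; first exact: ltW.
move=> u v xu uv vy'; apply: (local_to_global hM) => // w /andP[uw wv].
  by have [] := h w (lt_le_trans xu uw) (lt_trans wv vy').
have [_] := h w (lt_trans xu uw) (le_lt_trans wv vy').
by rewrite /R s'E; apply: germS => z; rewrite oltN.
Qed.

Definition rel_monotone_near t Y F c := exists x y, [/\ x < c, c < y,
  forall z, x < z -> z < y -> Y z & rel_monotone t F x y].

(** The neighbourhood is required to lie in Y, so that the isolated points and
    the boundary points of Y belonging to Y are among the non-monotone ones. A
    convex subset of Y without such points then lies in the interior of Y. *)
Definition monotone_at Y F c := exists t, rel_monotone_near t Y F c.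

Definition non_monotone_points Y F c := Y c /\ ~ monotone_at Y F c.

Lemma fo_ex_option_bool (P : option bool -> (nat -> M) -> Prop) :
  (forall t, fo_pred (P t)) -> fo_pred (fun e => exists t, P t e).
Proof.
move=> h.
apply: fo_ext (fo_or (fo_or (h (Some true)) (h (Some false))) (h None)) => _ e.
split; first by case=> [[]|] ?;
  do ?[by exists (Some true)|by exists (Some false)|by exists None].
by case=> -[[]|] ?; do ?[by left; left|by left; right|by right].
Qed.

Lemma def_set_mono_near t Y F : def_set Y -> def_fun F ->
  def_set (rel_monotone_near t Y F).
Proof.
move=> dY dF; rewrite /def_set /fo_pred.
apply: (@fo_ext _ _ _ _ _ (fun _ e => exists x y, (x < e 0 /\ e 0 < y) /\
  ((forall z, x < z -> z < y -> Y z) /\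
   forall u v, x < u -> u < v -> v < y -> rel_of t (F u) (F v)))).
  by move=> _ e; split=> -[x [y h]]; exists x, y;
    [case: h => [[? ?] [? ?]]|case: h].
have dR r r' : fo_fun r -> fo_fun r' ->
    fo_pred (fun e => rel_of t (F (r e)) (F (r' e))).
  by move=> hr hr'; apply: fo_rel; exact: fo_pred_app.
by definability; apply: dR; definability.
Qed.

Lemma def_set_non_monotone Y F : def_set Y -> def_fun F ->
  def_set (non_monotone_points Y F).
Proof.
move=> dY dF; apply: fo_and => //; apply: fo_not; apply: fo_ex_option_bool => t.
exact: def_set_mono_near.
Qed.

(** An interval of such points would be contained in Y, and would have a
    monotone subinterval. *)
Lemma non_monotone_no_interior Y F : def_fun F ->
  no_interior (non_monotone_points Y F).
Proof.
move=> dF x y xy; apply: contrapT => h.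
have {}h z : x < z -> z < y -> non_monotone_points Y F z.
  by move=> xz zy; apply: contrapT => nz; apply: h; exists z => //; rewrite xz.
have [t [x' [y' [xx' x'y' y'y m]]]] := locally_monotone dF xy.
have [c x'c cy'] := olt_dense (b := true) x'y'.
case: (h c _ _); [exact: le_lt_trans x'c|exact: lt_le_trans y'y|move=> _; apply].
exists t, x', y'; split=> // z x'z zy'.
by case: (h z _ _); [exact: le_lt_trans x'z|exact: lt_le_trans y'y|].
Qed.

(** Being monotone of kind t near a point is an open condition on the point, and
    excludes the other kinds; so by [first_exit] the kind at x propagates to the
    whole segment, and [local_to_global] applies. *)
Lemma mono_on_segment Y F x y : def_set Y -> def_fun F ->
  (forall z, x <= z <= y -> monotone_at Y F z) -> x < y ->
  exists t, forall u v, x <= u -> u < v -> v <= y -> rel_of t (F u) (F v).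
Proof.
move=> dY dF h xy.
pose A t c := rel_monotone_near t Y F c.
have dA t : def_set (A t) by exact: def_set_mono_near.
have openA t c b : A t c -> germ b (Some c) (A t).
  move=> [x' [y' [x'c cy' hY m]]].
  by apply: germS (germ_inside b x'c cy') => z [x'z zy']; exists x', y'.
have uniqA t t' c : A t c -> A t' c -> t = t'.
  move=> [x1 [y1 [x1c cy1 _ m1]]] [x2 [y2 [x2c cy2 _ m2]]].
  have [d cd hd] := germI (germ_inside true x1c cy1) (germ_inside true x2c cy2).
  have [v cv vd] := olt_dense cd.
  have [[_ vy1] [_ vy2]] := hd v cv vd.
  exact: rel_of_inj (m1 c v x1c cv vy1) (m2 c v x2c cv vy2).
have [|t Axt] := h x; first by rewrite lexx ltW.
have At z : x <= z <= y -> A t z.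
  move=> /andP[]; rewrite le_eqVlt => /orP[/eqP <-//|xz] zy.
  apply: contrapT => nAz.
  have [s [/= xs sz sA hs]] :=
    first_exit hM (dA t) (openA t x true Axt) (xz : after true (Some x) z) nAz.
  have [|t' At's] := h s; first by rewrite (ltW xs); exact: le_trans zy.
  have [w _ [[ws xw] Aw]] :=
    germ_ex (germI (germ_itv (xs : olt false s x)) (openA _ _ false At's)).
  have E : t = t' by apply: uniqA Aw; apply: sA.
  rewrite -E in At's; case: hs => //.
  move=> /(germ_disjoint (openA t s true At's)); exact.
exists t => u v xu uv vy; apply: (local_to_global hM) => // z /andP[h1 h2].
  have [|x' [y' [x'z zy' _ m]]] := At z.
    by rewrite (le_trans xu h1) (le_trans (ltW h2) vy).
  by exists y' => // w zw wy'; exact: m.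
have [|x' [y' [x'z zy' _ m]]] := At z.
  by rewrite (le_trans xu (ltW h1)) (le_trans h2 vy).
by exists x' => // w zw wx'; exact: m.
Qed.

End Monotone.

(** * Topology *)

Section Topology.
Variables (L : language) (M : structure L).
Hypothesis hM : o_minimalistic M.
Implicit Types (b s : bool) (A Y P : set M) (F : M -> M).

(** Topological notions become statements about germs, which the germ dichotomy
    decides for definable sets. *)
Lemma nbhs_germ c P : nbhs c P <-> P c /\ forall b, germ b (Some c) P.
Proof.
split=> [nP|[Pc gP]].
  split; first exact: nbhs_singleton.
  move: nP; rewrite itv_nbhsE => -[i [oi ci] iP] b.
  apply: (@germS _ _ _ _ (fun x => x \in i)) => [x xi|]; first exact: iP.
  have [l lc] := univ_no_min c; have [r cr] := univ_no_max c.
  move: ci oi {iP}; case: i => [[[] x|[]] [[] y|[]]] //;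
    rewrite in_itv /= ?andbT => ci _.
  - case/andP: ci => xc cy.
    by apply: germS (germ_inside b xc cy) => z [? ?]; rewrite in_itv /=;
      apply/andP.
  - by apply: germS (germ_inside b ci cr) => z [? ?]; rewrite in_itv /= andbT.
  - by apply: germS (germ_inside b lc ci) => z [? ?]; rewrite in_itv.
  - exact: germT.
have [r cr hr] := gP true; have [l lc hl] := gP false.
apply: (@filterS _ _ _ `]l, r[%classic).
  move=> x /=; rewrite in_itv /= => /andP[lx xr].
  by have [xc|->//|cx] := olt_total true x c; [exact: hl|exact: hr].
apply: open_nbhs_nbhs; split; first exact: itv_open.
by rewrite /= in_itv /=; apply/andP.
Qed.

Lemma no_interior_discrete A : def_set A -> no_interior A -> discrete_set A.
Proof.
move=> dA nA c Ac; split; first exact: mem_set.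
exists [set x | x = c \/ ~ A x].
  apply/nbhs_germ; split=> [|b]; first by left.
  by apply: germS (no_interior_germ hM b (Some c) dA nA) => x; right.
by apply/seteqP; split=> [x [[->|]//]|x ->]; split=> //; left.
Qed.

Lemma no_interior_closed A : def_set A -> no_interior A -> closed A.
Proof.
move=> dA nA; rewrite -openC openE => c nAc; apply/nbhs_germ; split=> // b.
exact: no_interior_germ.
Qed.

Lemma no_interior_bounded A : def_set A -> no_interior A -> order_bounded A.
Proof.
move=> dA nA; split.
  have [x _ h] := no_interior_germ hM true None dA nA.
  by exists x => y Ay; rewrite leNgt; apply/negP => yx; exact: (h y).
have [x _ h] := no_interior_germ hM false None dA nA.
by exists x => y Ay; rewrite leNgt; apply/negP => yx; exact: (h y).
Qed.

Lemma continuous_germP Y F c : F @ within Y (nbhs c) --> F c <->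
  forall u v, u < F c -> F c < v ->
    forall b, germ b (Some c) (fun x => Y x -> u < F x /\ F x < v).
Proof.
split=> [h u v uc cv b|h V /nbhs_germ[Vc gV]].
  have /h /nbhs_germ[_ /(_ b)] : nbhs (F c) (fun z => u < z /\ z < v) by
    apply/nbhs_germ; split=> // b'; exact: germ_inside.
  by apply: germS.
apply/nbhs_germ; split=> // b.
have [v cv hv] := gV true; have [u uc hu] := gV false.
apply: germS (h u v uc cv b) => x /= hx /hx[ux xv].
by have [xc|->//|cx] := olt_total true (F x) (F c); [exact: hu|exact: hv].
Qed.

Lemma def_set_discontinuities Y F : def_set Y -> def_fun F ->
  def_set (discontinuities Y F).
Proof.
move=> dY dF.
suff h : def_set (fun c => Y c /\ ~ forall u v, u < F c -> F c < v ->
   germ true (Some c) (fun x => Y x -> u < F x /\ F x < v) /\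
   germ false (Some c) (fun x => Y x -> u < F x /\ F x < v)).
  apply: fo_ext h => _ e; rewrite /discontinuities /=.
  split=> -[Yc h]; split=> // h'; apply: h.
    move=> u v uc cv; have := (continuous_germP _ _ _).1 h' u v uc cv.
    by split.
  by apply/continuous_germP => u v uc cv; have [? ?] := h' u v uc cv; case.
definability.
Qed.

(** On a monotone subinterval, constant maps are continuous. If F is strictly
    monotone, its range there is not contained in a set without interior, since
    F is not constant on any interval; so the range contains an interval, and F
    is continuous at a preimage c of a point w inside: the values slightly below
    and slightly above w are attained, at points that surround c. *)
Lemma discontinuities_no_interior Y F : def_set Y -> def_fun F ->
  no_interior (discontinuities Y F).
Proof.
move=> dY dF x y xy; apply: contrapT => h.
have {}h z : x < z -> z < y -> discontinuities Y F z.
  by move=> xz zy; apply: contrapT => nz; apply: h; exists z => //; rewrite xz.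
have [t [x' [y' [xx' x'y' y'y m]]]] := locally_monotone hM dF xy.
have {h xx' y'y} h z : x' < z -> z < y' ->
    (forall u v, u < F z -> F z < v -> exists l r, [/\ l < z, z < r &
      forall w, l < w -> w < r -> u < F w /\ F w < v]) -> False.
  move=> x'z zy' hz.
  case: (h z); [exact: le_lt_trans x'z|exact: lt_le_trans y'y|move=> _; apply].
  apply/continuous_germP => u v uz zv b.
  have [l [r [lz zr hw]]] := hz u v uz zv.
  by apply: germS (germ_inside b lz zr) => w [lw wr] _; exact: hw.
case: t m => [s|] m; last first.
  have [c x'c cy'] := olt_dense (b := true) x'y'.
  apply: (h c x'c cy') => u v uc cv; exists x', y'; split=> // w x'w wy'.
  suff -> : F w = F c by [].
  by have [wc|->//|cw] := olt_total true w c; [exact: m|symmetry; exact: m].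
have ms u v : x' < u -> u < y' -> x' < v -> v < y' -> F u < F v -> olt s u v.
  move=> x'u uy' x'v vy' uv; have := uv.
  have [uv'|->|vu] := olt_total true u v; rewrite ?ltxx //.
    by have := m u v x'u uv' vy'; case: (s) => //= /lt_trans/(_ uv); rewrite ltxx.
  by have := m v u x'v vu uy'; case: (s) => //= /lt_trans/(_ uv); rewrite ltxx.
have ms' u v : x' < u -> u < y' -> x' < v -> v < y' -> olt s u v -> F u < F v.
  by move=> x'u uy' x'v vy'; case: (s) m => m uv; exact: m.
pose J w := exists z, (x' < z /\ z < y') /\ F z = w.
have dJ : def_set J by rewrite /J; definability.
case: (pselect (no_interior J)) => [nJ|].
  have x'y'J : germ true (Some x') (fun z => J (F z)).
    by exists y' => // z *; exists z.
  have [d [y0 x'y0 hd]] := germ_into_no_interior hM dF dJ nJ x'y'J.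
  have [w x'w] := olt_dense (after_omin (x'y0 : after true (Some x') y0) x'y').
  rewrite olt_omin => /andP[wy0 wy'].
  have [w' x'w' w'w] := olt_dense (x'w : olt true x' w).
  have := m w' w x'w' w'w wy'.
  by rewrite /= (hd w x'w wy0) (hd w' x'w' (olt_trans w'w wy0)) oltxx.
move=> /existsNP[a /existsNP[b /not_implyP[ab hJ]]].
have {hJ} hJ w : a < w -> w < b -> J w.
  by move=> aw wb; apply: contrapT => nJ; apply: hJ; exists w => //; rewrite aw.
have [w aw wb] := olt_dense (ab : olt true a b).
have [c [[x'c cy'] Fc]] := hJ w aw wb.
apply: (h c x'c cy') => u v; rewrite Fc => uw wv.
have [w1] := olt_dense (after_omin (uw : after false (Some w) u) aw).
rewrite olt_omin => w1w /andP[uw1 aw1].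
have [w2 ww2] := olt_dense (after_omin (wv : after true (Some w) v) wb).
rewrite olt_omin => /andP[w2v w2b].
have [c1 [[x'c1 c1y'] Fc1]] := hJ w1 aw1 (lt_trans w1w wb).
have [c2 [[x'c2 c2y'] Fc2]] := hJ w2 (lt_trans aw ww2) w2b.
have c1c : olt s c1 c by apply: ms; rewrite ?Fc1 ?Fc.
have cc2 : olt s c c2 by apply: ms; rewrite ?Fc2 ?Fc.
have key z : x' < z -> z < y' -> olt s c1 z -> olt s z c2 -> u < F z /\ F z < v.
  move=> x'z zy' c1z zc2; split.
    by apply: lt_trans (ms' c1 z _ _ _ _ c1z); rewrite ?Fc1.
  by apply: lt_trans (ms' z c2 _ _ _ _ zc2) _; rewrite ?Fc2.
case: s m {ms ms'} c1c cc2 key => m c1c cc2 key.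
  exists c1, c2; split=> // z c1z zc2.
  by apply: key => //; [exact: lt_trans c1z|exact: lt_trans zc2 _].
exists c2, c1; split=> // z c2z zc1.
by apply: key => //; [exact: lt_trans c2z|exact: lt_trans zc1 _].
Qed.

Definition part b Y c := if b then right_part Y c else left_part Y c.
Definition side_limit b Y F c l :=
  if b then right_limit Y F c l else left_limit Y F c l.

Lemma side_limitE b Y F c l : side_limit b Y F c l <->
  limit_point (part b Y c) c /\ F @ within (part b Y c) (nbhs c) `=>` ext_nbhs l.
Proof. by case: b. Qed.

Lemma partE b Y c x : part b Y c x <-> Y x /\ olt b c x.
Proof.
by case: b; rewrite /part /right_part /left_part /= in_itv /= ?andbT.
Qed.

Lemma within_part b Y c P :
  within (part b Y c) (nbhs c) P <-> germ b (Some c) (fun x => Y x -> P x).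
Proof.
rewrite /within /=; split=> [/nbhs_germ[_ /(_ b)[y cy h]]|[y cy h]].
  by exists y => // x cx xy Yx; apply: h => //; apply/partE.
apply/nbhs_germ; split=> [/partE[_]|b']; first by rewrite oltxx.
case: (eqVneq b' b) => [->|bb'].
  by exists y => // x cx xy /partE[Yx _]; exact: h.
have {bb'} -> : b' = ~~ b by case: b b' bb' {h cy} => -[].
have [z cz] := olt_unbounded (~~ b) c; exists z => // x /=.
by rewrite oltN => xc _ /partE[_ cx]; have := olt_trans xc cx; rewrite oltxx.
Qed.

(** By the germ dichotomy, accumulation from one side means containing an
    interval on that side. *)
Lemma limit_point_part b Y c : def_set Y ->
  limit_point (part b Y c) c <-> germ b (Some c) Y.
Proof.
move=> dY; split=> [h|h U /nbhs_germ[_ /(_ b) hU]]; last first.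
  have [x cx [Yx Ux]] := germ_ex (germI h hU).
  exists x; split=> //; last exact/partE.
  by apply/eqP => E; move: cx; rewrite /= E oltxx.
apply: contrapT => /(germ_complete hM dY) nY.
have /h[y [_ py]] : within (part b Y c) (nbhs c) (fun x => ~ part b Y c x).
  by apply/within_part; apply: germS nY => x nYx /nYx.
by move=> /(_ py).
Qed.

(** A constant or a place, as provided by [germ_push], determines a limit in the
    extended line. *)
Lemma side_limit_ex b Y F c : def_set Y -> def_fun F -> germ b (Some c) Y ->
  exists l, side_limit b Y F c l.
Proof.
move=> dY dF gY.
suff [l hl] : exists l, forall P,
    ext_nbhs l P -> germ b (Some c) (fun x => P (F x)).
  exists l; apply/side_limitE; split; first exact/limit_point_part.
  by move=> P /hl hP; apply/within_part; apply: germS hP => x.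
have [[d hd]|[b' [[e|] h]]] := germ_push hM b (Some c) dF.
- by exists (EFin d) => P /nbhs_singleton Pd; apply: germS hd => x /= ->.
- by exists (EFin e) => P /nbhs_germ[_ hP]; apply: h.
- exists (if b' then -oo else +oo)%E => P hP; apply: h.
  by case: b' hP => -[a _ aP]; exists a => // x _ xa; apply: aP;
    rewrite /= in_itv /= ?andbT.
Qed.

(** F is continuous at c as soon as each side from which Y accumulates at c has
    limit F c; the types are told apart by the number of these sides and, when
    there are two, by the equality of the limits. *)
Lemma discontinuity_types Y F c : def_set Y -> def_fun F ->
  discontinuities Y F c ->
  [\/ jump_discontinuity Y F c, removable_discontinuity Y F c |
      endpoint_discontinuity Y F c].
Proof.
move=> dY dF [Yc nc].
have cont : ~ forall b, germ b (Some c) Y -> side_limit b Y F c (EFin (F c)).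
  move=> h; apply: nc; apply/continuous_germP => u v uc cv b.
  have [gY|nY] := germ_decide hM b (Some c) dY; last by apply: germS nY.
  have /side_limitE[_ hl] := h b gY.
  apply/within_part; apply: (hl (fun z => u < z /\ z < v)).
  by apply/nbhs_germ; split=> // b'; exact: germ_inside.
have nl b : germ b (Some c) (fun x => ~ Y x) -> ~ limit_point (part b Y c) c.
  by move=> nY /(limit_point_part _ _ dY) gY; exact: germ_disjoint nY.
have [gl|gl] := germ_decide hM false (Some c) dY;
  have [gr|gr] := germ_decide hM true (Some c) dY.
- have [l hl] := side_limit_ex dY dF gl; have [r hr] := side_limit_ex dY dF gr.
  case: (pselect (l = r)) => [lr|lr]; last by constructor 1; exists l, r.
  rewrite -lr in hr; constructor 2; exists l; split=> // lc.
  by apply: cont => -[] _; rewrite -lc.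
- have [l hl] := side_limit_ex dY dF gl.
  constructor 3; left; exists l; split=> //; first exact: (nl true).
  by move=> lc; apply: cont => -[] gY; [case: (germ_disjoint gY gr)|rewrite -lc].
- have [r hr] := side_limit_ex dY dF gr.
  constructor 3; right; exists r; split=> //; first exact: (nl false).
  by move=> rc; apply: cont => -[] gY; [rewrite -rc|case: (germ_disjoint gY gl)].
- by case: cont => -[] gY; [case: (germ_disjoint gY gr)|case: (germ_disjoint gY gl)].
Qed.

(** The kind of monotonicity on a segment is determined by any two of its
    points, and any two segments of C lie in a common one. *)
Lemma monotone_on_convex Y F C : def_set Y -> def_fun F -> order_convex C ->
  (forall c, C c -> monotone_at Y F c) -> monotone_on C F.
Proof.
move=> dY dF cC hC.
case: (pselect (exists x y, [/\ C x, C y & x < y]))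
  => [[x [y [Cx Cy xy]]]|h]; last first.
  constructor 3 => x y Cx Cy.
  by case: (ltgtP x y) => [xy|xy|->//]; case: h; [exists x, y|exists y, x].
have seg u v : C u -> C v -> u < v -> exists t, forall u' v',
    u <= u' -> u' < v' -> v' <= v -> rel_of t (F u') (F v').
  move=> Cu Cv uv; apply: (mono_on_segment hM dY dF) => // z zuv.
  by apply: hC; exact: (cC u v).
have [t ht] := seg x y Cx Cy xy.
have {}ht u v : C u -> C v -> u < v -> rel_of t (F u) (F v).
  move=> Cu Cv uv.
  have Cm : C (Order.min u x) by case: (leP u x).
  have CM : C (Order.max v y) by case: (leP v y).
  have mM : Order.min u x < Order.max v y.
    by rewrite gt_min lt_max uv.
  have [t' ht'] := seg _ _ Cm CM mM.
  have -> : t = t'.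
    apply: (@rel_of_inj _ _ _ _ (F x) (F y)); first exact: ht.
    by apply: ht'; rewrite ?ge_min ?le_max ?lexx ?orbT.
  by apply: ht'; rewrite ?ge_min ?le_max ?lexx ?orbT.
case: t ht => [[]|] ht.
- by constructor 1 => u v; exact: ht.
- by constructor 2 => u v; exact: ht.
constructor 3 => u v Cu Cv.
by case: (ltgtP u v) => [uv|vu|->//]; [exact: ht|symmetry; exact: ht].
Qed.

Lemma fmap_within_eq Y A f F (c : M) :
  A `<=` Y -> (forall x, Y x -> F x = f x) ->
  f @ within A (nbhs c) = F @ within A (nbhs c).
Proof.
move=> AY fF; apply: funext => P; apply: propext.
have h (g1 g2 : M -> M) : (forall x, Y x -> g1 x = g2 x) ->
    nbhs c [set x | A x -> P (g1 x)] -> nbhs c [set x | A x -> P (g2 x)].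
  by move=> g12; apply: filterS => x h Ax; rewrite -g12; [exact: h|exact: AY].
by split; apply: h => x Yx; rewrite fF.
Qed.

(** Outside Y, the values of f are arbitrary; the identity there makes the whole
    map definable. *)
Lemma definable_map_extension Y f : definable_map Y f ->
  exists2 F, def_fun F & def_set Y /\ forall x, Y x -> F x = f x.
Proof.
move=> hf.
pose k (i : 'I_2) : nat := if i == ord0 then 1 else 0.
have dG : fo_pred (fun e => Y (e 1) /\ e 0 = f (e 1)).
  exact: (fo_pred_definable k hf).
have dY : def_set Y.
  apply: fo_ext (fo_ex (P := fun _ e x => Y (e 0) /\ x = f (e 0)) dG) => _ e.
  by split=> [[x []//]|Ye]; exists (f (e 0)).
exists (fun x => if pselect (Y x) then f x else x); last first.
  by split=> // x Yx; case: pselect.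
apply: (@fo_ext _ _ _ _ _ (fun _ e => (Y (e 1) /\ e 0 = f (e 1)) \/
    (~ Y (e 1) /\ e 1 = e 0))) => [_ e|].
  case: pselect => Ye; split; rewrite /=.
  - by case=> -[].
  - by left.
  - by case=> -[].
  - by right.
by apply: fo_or => //; definability.
Qed.

End Topology.

Theorem theorem4p2 (L : language) (M : structure L) (Y : set M) (f : M -> M)
    (hM : o_minimalistic M) (hf : definable_map Y f) :
  [/\ discrete_set (discontinuities Y f),
      closed (discontinuities Y f),
      order_bounded (discontinuities Y f) &
      forall c : M, discontinuities Y f c ->
        [\/ jump_discontinuity Y f c,
            removable_discontinuity Y f c |
            endpoint_discontinuity Y f c]] /\
  exists D : set M,
    [/\ definable_set D, D `<=` Y &
        [/\ discrete_set D, closed D & order_bounded D]] /\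
    forall p q : \bar M, consecutive D p q ->
      forall C : set M, order_convex C -> C `<=` Y `&` between p q ->
        monotone_on C f.
Proof.
have [F dF [dY fF]] := definable_map_extension hf.
have fmE (A : set M) (c : M) : A `<=` Y ->
    f @ within A (nbhs c) = F @ within A (nbhs c).
  move=> AY; exact (fmap_within_eq c AY fF).
have dE : discontinuities Y f = discontinuities Y F.
  by apply/seteqP; split=> c [Yc nc]; split=> //; move: nc; rewrite fmE // fF.
have lE : left_limit Y f = left_limit Y F.
  by apply: funext => c; apply: funext => l; rewrite /left_limit fmE // => x [].
have rE : right_limit Y f = right_limit Y F.
  by apply: funext => c; apply: funext => l; rewrite /right_limit fmE // => x [].
split.
  have dD := def_set_discontinuities dY dF.
  have nD := discontinuities_no_interior hM dY dF.
  split.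
  - by rewrite dE; exact: no_interior_discrete.
  - by rewrite dE; exact: no_interior_closed.
  - by rewrite dE; exact: no_interior_bounded.
  move=> c; rewrite dE => Dc; have [Yc _] := Dc.
  rewrite /jump_discontinuity /removable_discontinuity /endpoint_discontinuity.
  by rewrite lE rE -(fF c Yc); exact: discontinuity_types.
exists (non_monotone_points Y F).
have dD := def_set_non_monotone dY dF.
have nD := non_monotone_no_interior hM Y dF.
split.
  split; [exact/def_setP|by move=> x []|split].
  - exact: no_interior_discrete.
  - exact: no_interior_closed.
  - exact: no_interior_bounded.
move=> p q [_ _ _ Dpq] C cC CY.
have : monotone_on C F.
  apply: (monotone_on_convex hM dY dF cC) => c Cc.
  have [Yc pcq] := CY c Cc; apply: contrapT => nm.
  by rewrite -[False]/((set0 : set M) c) -Dpq.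
have FC x : C x -> F x = f x by move=> /CY[/fF].
case=> h; [constructor 1|constructor 2|constructor 3] => x y Cx Cy;
  by move: (h x y Cx Cy); rewrite !FC.
Qed.
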